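(* Let $I$ be a yes-instance of \textsc{Stars NWS}. Then for every optimal solution $G'=(V,E')$ of $I$ there is an edge set $E^*\subseteq E'$ with $|E^*|\le 4t$ such that the edge set of every local cycle of $G'$ is a subset of $E^*$.
   Context: \textsc{Stars NWS}: given a graph $G=(V,E)$ with $n$ vertices, a collection $\mathcal{C}$ of subsets of $V$ (communities), $\omega:E\to\mathbb{R}_+$, an integer $\ell$ and a positive real $b$, a solution is a spanning subgraph $G'=(V,E')$ with $E'\subseteq E$, $|E'|\le\ell$, $\omega(E')\le b$, such that for each $C\in\mathcal{C}$ the set $\mathrm{univ}_{G'}(C)$ of vertices $u\in C$ adjacent in $G'$ to all of $C\setminus\{u\}$ is nonempty. An optimal solution is a solution with the minimum number of edges. The parameter is $t=\ell-n+x$ where $x$ is the number of connected components of the hypergraph $(V,\mathcal{C})$. Two distinct communities $C_1,C_2$ induce a local cycle in $G'$ if there are $c_i\in\mathrm{univ}_{G'}(C_i)$ ($i=1,2$) such that the graph on $C_1\cup C_2$ with edge set $\{\{c_i,w\}: w\in C_i\setminus\{c_i\}, i\in\{1,2\}\}$ contains a cycle; each cycle of this graph is a local cycle of $G'$. *)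

(* Defs.v *)
From HB Require Import structures.
From mathcomp Require Import all_boot all_order all_algebra.
From mathcomp Require Import reals.

Set Implicit Arguments.
Unset Strict Implicit.
Unset Printing Implicit Defensive.

Import Order.TTheory GRing.Theory Num.Theory.

Local Open Scope ring_scope.

Section EdgeSets.

Variable V : finType.

(* The edge set of a simple graph on V is a set of two-element sets; spanning
   subgraphs are identified with their edge sets. *)
Definition adj (F : {set {set V}}) : rel V :=
  fun u v => (u != v) && ([set u; v] \in F).

Definition univ (F : {set {set V}}) (C : {set V}) : {set V} :=
  [set u in C | [forall w in C :\ u, adj F u w]].

Definition star (c : V) (C : {set V}) : {set {set V}} :=
  [set [set c; w] | w in C :\ c].

(* A cycle is given by the cyclic sequence of its pairwise distinct vertices. *)
Definition is_cycle (F : {set {set V}}) (p : seq V) : Prop :=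
  (2 < size p)%N /\ ucycle (adj F) p.

Definition cycle_edges (p : seq V) : {set {set V}} :=
  [set [set v; next p v] | v in p].

Definition hyper_adj (H : {set {set V}}) : rel V :=
  fun u v => [exists C in H, (u \in C) && (v \in C)].

Lemma hyper_adj_connect_sym (H : {set {set V}}) : connect_sym (hyper_adj H).
Proof.
apply: sym_connect_sym => u v; apply: eq_existsb => C.
by rewrite [(u \in C) && _]andbC.
Qed.

(* Vertices in no member of H count as components of their own. *)
Definition hyper_components (H : {set {set V}}) : nat :=
  n_comp (hyper_adj H) [set: V].

End EdgeSets.

(* Weights are only meaningful on the edges of the instance. *)
Record stars_nws (R : realType) (V : finType) := StarsNWS {
  edges : {set {set V}};
  edges_card2 : forall e, e \in edges -> #|e| = 2%N;
  communities : {set {set V}};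
  weight : {set V} -> R;
  weight_ge0 : forall e, e \in edges -> 0 <= weight e;
  edge_bound : int;
  weight_bound : R;
  weight_bound_gt0 : 0 < weight_bound
}.

Section Solutions.

Variables (R : realType) (V : finType) (I : stars_nws R V).

Definition solution (F : {set {set V}}) : Prop :=
  [/\ F \subset edges I,
      #|F|%:Z <= edge_bound I,
      \sum_(e in F) weight I e <= weight_bound I
    & forall C, C \in communities I -> univ F C != set0].

Definition yes_instance : Prop := exists F, solution F.

Definition optimal_solution (F : {set {set V}}) : Prop :=
  solution F /\ forall F', solution F' -> (#|F| <= #|F'|)%N.

Definition parameter : int :=
  edge_bound I - #|V|%:Z + (hyper_components (communities I))%:Z.

(* The edges of both stars lie within C1 :|: C2, so the cycles of the graph on
   C1 :|: C2 are those of the union of the two stars. *)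
Definition local_cycle (F : {set {set V}}) (p : seq V) : Prop :=
  exists C1 C2 : {set V}, exists c1 c2 : V,
    [/\ [/\ C1 \in communities I, C2 \in communities I & C1 <> C2],
        c1 \in univ F C1, c2 \in univ F C2
      & is_cycle (star c1 C1 :|: star c2 C2) p].

End Solutions.

(* Main.v *)
Require Import Defs.
From HB Require Import structures.
From mathcomp Require Import all_boot all_order all_algebra.
From mathcomp Require Import reals.
From mathcomp Require Import zify.
Import Order.TTheory GRing.Theory Num.Theory.
Local Open Scope ring_scope.

(** The cyclomatic number of [E'] is at most [t], because the members of a
    community are connected in [E'].  An edge set [U] of [E'] that is maximal
    subject to [#|U|] being at most four times the cyclomatic number of [U]
    contains every cycle of length at most 4: adding such a cycle brings in at
    most four new edges and raises the cyclomatic number, since the last of the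
    new edges closes a cycle.  Local cycles have length at most 4, because the
    two centers cover all edges of the two stars. *)

(** * Comparing numbers of connected components *)

Section Components.

Variable T : finType.
Implicit Types e : rel T.

(** A map constant along edges is constant on components, so all its values are already taken at the
    roots. *)
Lemma leq_imset_n_comp (S : finType) e (f : T -> S) :
  connect_sym e -> (forall x y, e x y -> f x = f y) ->
  (#|f @: [set: T]| <= n_comp e [set: T])%N.
Proof.
move=> e_sym f_inv.
have f_connect x y : connect e x y -> f x = f y.
  case/connectP=> q; elim: q x => [x _ -> //|z q IHq x /= /andP[exz q_path] y_last].
  by rewrite (f_inv _ _ exz); apply: IHq.
rewrite /n_comp_mem.
apply: leq_trans _ (leq_imset_card f _); apply/subset_leq_card/subsetP => _ /imsetP[x _ ->].
rewrite (f_connect _ _ (connect_root e x)); apply: imset_f.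
by rewrite !inE (roots_root e_sym).
Qed.

(** The root map of [e'] is constant along [e], and its image contains every root of [e']. *)
Lemma leq_n_comp e e' :
    connect_sym e -> connect_sym e' -> subrel e (connect e') ->
  (n_comp e' [set: T] <= n_comp e [set: T])%N.
Proof.
move=> e_sym e'_sym ee'.
have root_inv x y : e x y -> fingraph.root e' x = fingraph.root e' y.
  by move=> /ee' xy; apply/(fingraph.rootP e'_sym).
apply: leq_trans (leq_imset_n_comp _ _ _ e_sym root_inv).
apply/subset_leq_card/subsetP => x; rewrite !inE andbT => /eqP <-.
exact: imset_f.
Qed.

End Components.

(** * The cyclomatic number of an edge set *)

Section Cyclomatic.

Variable V : finType.
Implicit Types (F U W : {set {set V}}) (C : {set V}) (p : seq V).

Definition components F : nat := n_comp (adj F) [set: V].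

Lemma adj_sym F : symmetric (adj F).
Proof. by move=> u v; rewrite /adj eq_sym setUC. Qed.

Lemma adj_connect_sym F : connect_sym (adj F).
Proof. exact/sym_connect_sym/adj_sym. Qed.

Lemma components0 : (#|V| <= components set0)%N.
Proof.
rewrite -cardsT -(imset_id [set: V]).
apply: leq_imset_n_comp; first exact: adj_connect_sym.
by move=> x y; rewrite /adj inE andbF.
Qed.

Lemma components_setU1 F (u v : V) :
  (components F <= (components ([set u; v] |: F)).+1)%N.
Proof.
pose r := fingraph.root (adj F); have rE := fingraph.rootP (adj_connect_sym F).
(* [f] merges the class of [v] into that of [u]: it is constant along the edges of the enlarged
   graph, and the only root its image can miss is [r v]. *)
pose f x := if r x == r v then r u else r x.
have ruv : f u = f v by rewrite /f eqxx; case: ifP.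
have f_inv x y : adj ([set u; v] |: F) x y -> f x = f y.
  case/andP=> xy; rewrite in_setU1 => /orP[/eqP xyE|Fxy]; last first.
    have /rE rxy : connect (adj F) x y by rewrite connect1 // /adj xy.
    by rewrite /f /r rxy.
  have : x \in [set u; v] by rewrite -xyE set21.
  have : y \in [set u; v] by rewrite -xyE set22.
  by move: xy; rewrite !inE => xy /orP[] /eqP yE /orP[] /eqP xE;
     rewrite ?xE ?yE // ?ruv // in xy *; rewrite eqxx in xy.
apply: (@leq_trans (#|f @: [set: V]|).+1); last first.
  exact: leq_imset_n_comp _ _ f (adj_connect_sym _) f_inv.
have roots_sub : [set x in roots (adj F)] \subset r v |: f @: [set: V].
  apply/subsetP=> x; rewrite !inE => /eqP rx.
  have [xrv|xrv] := eqVneq x (r v) => //=.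
  by apply/imsetP; exists x; rewrite // /f /r rx (negPf xrv).
rewrite /components /n_comp_mem.
have -> : #|[predI roots (adj F) & [set: V]]| = #|[set x in roots (adj F)]|.
  by apply: eq_card => x; rewrite !inE andbT.
apply: leq_trans (subset_leq_card roots_sub) _.
by rewrite cardsU1 -add1n leq_add2r leq_b1.
Qed.

(* The cyclomatic number [#|U| + components U - #|V|] is nondecreasing. *)
Lemma leq_card_components U W :
    U \subset W -> (forall e, e \in W -> #|e| = 2) ->
  (#|U| + components U <= #|W| + components W)%N.
Proof.
elim: {W}#|W| {-2}W (leqnn #|W|) => [|n IHn] W W_le UW W2.
  move: W_le UW; rewrite leqn0 cards_eq0 => /eqP ->.
  by rewrite subset0 => /eqP ->.
have [/eqP WU0|[e]] := set_0Vmem (W :\: U).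
  rewrite setD_eq0 in WU0.
  by have -> : U = W by apply/eqP; rewrite eqEsubset UW.
rewrite inE => /andP[eU eW].
have /IHn : (#|W :\ e| <= n)%N by rewrite (cardsD1 e W) eW in W_le.
have UWe : U \subset W :\ e.
  by apply/subsetP=> x xU; rewrite !inE (subsetP UW) // andbT; apply: contraNneq eU => <-.
move=> /(_ UWe (fun x xWe => W2 x (subsetP (subsetDl W [set e]) x xWe))) le_We.
have /eqP/cards2P[u [v [_ eE]]] := W2 e eW.
(* Deleting [e] loses one edge and creates at most one component, so the sum does not increase. *)
have := components_setU1 (W :\ e) u v.
rewrite -eE setD1K // => le_comp; have := cardsD1 e W; rewrite eW; lia.
Qed.

(** * Deleting and adding edges of cycles *)

Lemma cycle_adj_next F p x :
  is_cycle F p -> x \in p -> adj F x (next p x).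
Proof. by case=> _ /andP[p_cycle _]; apply: next_cycle. Qed.

Lemma cycle_edges_sub F p : is_cycle F p -> cycle_edges p \subset F.
Proof.
move=> p_cycle; apply/subsetP=> _ /imsetP[x xp ->].
by have /andP[] := cycle_adj_next F p x p_cycle xp.
Qed.

Lemma is_cycle_edges F U p :
  is_cycle F p -> cycle_edges p \subset U -> is_cycle U p.
Proof.
move=> p_cycle /subsetP pU; have [p_size /andP[F_cycle p_uniq]] := p_cycle.
split=> //; apply/andP; split=> //; apply: cycle_from_next => // x xp.
have /andP[xn _] := cycle_adj_next F p x p_cycle xp.
by rewrite /adj xn pU //; apply/imsetP; exists x.
Qed.

Lemma connect_cycle_setD1 F p x :
    is_cycle F p -> x \in p ->
  connect (adj (F :\ [set x; next p x])) x (next p x).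
Proof.
case=> p_size /andP[p_cycle p_uniq] xp.
have [i q pE] := rot_to xp.
rewrite -(next_rot i p_uniq) pE.
move: p_cycle p_uniq p_size.
rewrite -(rot_cycle i) -(rot_uniq i) -(size_rot i) pE.
(* The cycle now reads [x], [y], [z], then [q], and [y] is the successor of [x]; the detour runs
   from [y] through [z] and [q] back to [x]. *)
case: q {pE} => [|y [|z q]] //=; rewrite eqxx => /and3P[_ yz zq_path].
rewrite !inE !negb_or => /and4P[/and3P[xy xz xq] /andP[yz' yq] _ _] _.
(* Each edge of the detour has an end other than [x] and [y], so it differs from the deleted
   edge. *)
have adjD a b : a \notin [set x; y] -> adj F a b -> adj (F :\ [set x; y]) a b.
  move=> a_xy /andP[ab Fab]; rewrite /adj ab !inE Fab andbT /=.
  by apply: contraNneq a_xy => <-; rewrite set21.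
rewrite (adj_connect_sym _); apply/connectP; exists (z :: rcons q x); last first.
  by rewrite /= last_rcons.
rewrite /= adj_sym adjD ?(adj_sym F z) //=; last first.
  by rewrite !inE negb_or eq_sym xz eq_sym.
elim: q z zq_path xq yq {yz} xz yz' => [|w q IHq] z /=.
  rewrite !andbT => zx _ _ xz yz.
  by apply: adjD => //; rewrite !inE negb_or eq_sym xz eq_sym.
case/andP=> zw wq_path; rewrite !inE !negb_or => /andP[xw xq] /andP[yw yq] xz yz.
rewrite adjD //=; last by rewrite !inE negb_or eq_sym xz eq_sym.
exact: IHq.
Qed.

(** The rest of the cycle still joins the ends of the deleted edge. *)
Lemma components_cycle_setD1 F p e :
  is_cycle F p -> e \in cycle_edges p ->
  (components (F :\ e) <= components F)%N.
Proof.
move=> p_cycle /imsetP[x xp ->]; set e0 := [set _; _].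
apply: leq_n_comp; try exact: adj_connect_sym.
move=> a b /andP[ab Fab].
have [abE|abE] := eqVneq [set a; b] e0; last first.
  by apply: connect1; rewrite /adj ab !inE abE.
have := connect_cycle_setD1 F p x p_cycle xp; rewrite -/e0.
have : a \in e0 by rewrite -abE set21.
have : b \in e0 by rewrite -abE set22.
rewrite !inE => /orP[] /eqP bE /orP[] /eqP aE; move: ab; rewrite ?aE ?bE ?eqxx //.
by rewrite (adj_connect_sym _).
Qed.

Lemma card_cycle_edges p : (#|cycle_edges p| <= size p)%N.
Proof. by apply: leq_trans (leq_imset_card _ _) (card_size _). Qed.

(** The inequality bounds [#|U|] by [k] times the cyclomatic number of [F], with [k * #|V|] moved to
    the left to avoid truncated subtraction. *)
Lemma short_cycles_cover F (k : nat) :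
    (forall e, e \in F -> #|e| = 2) ->
  exists U : {set {set V}},
    [/\ U \subset F,
        (#|U| + k * #|V| <= k * (#|F| + components F))%N
      & forall p, is_cycle F p -> (size p <= k)%N -> cycle_edges p \subset U].
Proof.
move=> F2.
pose P U := (U \subset F) && (#|U| + k * #|V| <= k * (#|U| + components U))%N.
have P0 : P set0.
  by rewrite /P sub0set cards0 !add0n leq_mul2l components0 orbT.
have [U /maxsetP[/andP[UF U_le] U_max] _] := maxset_exists P0.
exists U; split=> //.
  apply: leq_trans U_le _; rewrite leq_mul2l; apply/orP; right.
  exact: leq_card_components.
move=> p p_cycle p_size; apply/negPn/negP => /subsetPn[e ep eU].
have pF := cycle_edges_sub F p p_cycle.
pose W := U :|: cycle_edges p.
have WF : W \subset F by rewrite subUset UF.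
have eW : e \in W by rewrite inE ep orbT.
have UWe : U \subset W :\ e.
  by apply/subsetP=> x xU; rewrite !inE xU /= andbT; apply: contraNneq eU => <-.
have We2 x : x \in W :\ e -> #|x| = 2.
  by rewrite inE => /andP[_ /(subsetP WF)/F2].
have W_cycle : is_cycle W p := is_cycle_edges F W p p_cycle (subsetUr _ _).
have le_comp := components_cycle_setD1 W p e W_cycle ep.
have le_cyc := leq_card_components U (W :\ e) UWe We2.
have W_card := cardsD1 e W; rewrite eW in W_card.
have W_le : (#|W| <= #|U| + k)%N.
  apply: leq_trans (leq_card_setU _ _) _; rewrite leq_add2l.
  exact: leq_trans (card_cycle_edges p) p_size.
(* [W] has at most [k] edges more than [U]. Its cyclomatic number is larger by at least one: that of
   [W :\ e] is at least that of [U], and putting [e] back adds an edge without merging components.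
   Hence [W] satisfies [P]. *)
have W_eq : W = U.
  apply: U_max (subsetUl _ _); rewrite -/W /P WF /=.
  apply: leq_trans (leq_add W_le (leqnn _)) _; rewrite addnAC.
  apply: leq_trans (leq_add U_le (leqnn k)) _.
  rewrite addnC -mulnS leq_mul2l W_card add1n addSn ltnS; apply/orP; right.
  by apply: leq_trans le_cyc _; rewrite leq_add2l.
by rewrite -W_eq eW in eU.
Qed.

(** * Stars, local cycles and communities *)

Lemma star_sub F C c : c \in univ F C -> star c C \subset F.
Proof.
rewrite inE => /andP[_ /forall_inP c_univ].
by apply/subsetP=> _ /imsetP[w wC ->]; case/andP: (c_univ w wC).
Qed.

Lemma size_cycle_stars (c1 c2 : V) (C1 C2 : {set V}) p :
  is_cycle (star c1 C1 :|: star c2 C2) p -> (size p <= 4)%N.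
Proof.
move=> p_cycle; have [_ /andP[_ p_uniq]] := p_cycle.
(* The edge from [x] to its successor contains a center, so [x] is a center or the predecessor of
   one. *)
apply: (uniq_leq_size (s2 := [:: c1; c2; prev p c1; prev p c2])) => // x xp.
have [c c12 cE] : exists2 c, c \in [:: c1; c2] & c \in [set x; next p x].
  have /andP[_] := cycle_adj_next _ _ _ p_cycle xp.
  by case/setUP=> /imsetP[w _ ->]; [exists c1|exists c2]; rewrite ?set21 // !inE eqxx ?orbT.
move: c12 cE; rewrite !inE => /orP[] /eqP -> /orP[] /eqP cE;
  by rewrite cE ?(prev_next p_uniq) eqxx ?orbT.
Qed.

(** Two vertices of a community are joined in [F] through any universal vertex of it. *)
Lemma components_le_hyper F (H : {set {set V}}) :
    (forall C, C \in H -> univ F C != set0) ->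
  (components F <= hyper_components H)%N.
Proof.
move=> H_univ; apply: leq_n_comp; first exact: hyper_adj_connect_sym.
  exact: adj_connect_sym.
move=> u v /existsP[C /and3P[/H_univ/set0Pn[c c_univ] uC vC]].
have c_connect w : w \in C -> connect (adj F) c w.
  move=> wC; have [->|wc] := eqVneq w c; first exact: connect0.
  apply: connect1; move: c_univ; rewrite inE => /andP[_ /forall_inP]; apply.
  by rewrite !inE wc.
by apply: connect_trans (c_connect v vC); rewrite (adj_connect_sym _) c_connect.
Qed.

End Cyclomatic.

Theorem lemma18 (R : realType) (V : finType) (I : stars_nws R V)
    (Iyes : yes_instance I) (E' : {set {set V}})
    (E'opt : optimal_solution I E') :
  exists Estar : {set {set V}},
    [/\ Estar \subset E',
        #|Estar|%:Z <= 4 * parameter I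
      & forall p : seq V, local_cycle I E' p -> cycle_edges p \subset Estar].
Proof.
have [[E'sub E'card _ E'univ] _] := E'opt.
have E'2 e : e \in E' -> #|e| = 2.
  by move=> /(subsetP E'sub); apply: edges_card2.
have [U [UE' U_le U_cycles]] := short_cycles_cover V E' 4 E'2.
exists U; split=> //.
  have := components_le_hyper V E' (communities I) E'univ.
  (* With [#|E'|] at most [edge_bound I], the cyclomatic number of [E'] is at most the parameter. *)
  rewrite /parameter; lia.
move=> p [C1 [C2 [c1 [c2 [_ c1_univ c2_univ p_cycle]]]]].
apply: U_cycles; last exact: size_cycle_stars p_cycle.
apply: is_cycle_edges (p_cycle) _.
apply: subset_trans (cycle_edges_sub _ _ _ p_cycle) _.
by rewrite subUset !star_sub.
Qed.
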